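(* Let $X$ be a real Banach space and $Y$ a closed linear subspace of $X$ such that $X$ admits weighted Chebyshev centers for all nonempty finite subsets of $Y$. Suppose that $Y$ has $n.X.I.P.$ in $X$ for all $n\in\mathbb{N}$. Then $Y$ is a central subspace of $X$ if and only if $Y\in(GC)$.
   Context: $B_X(a,r)$ and $B_Y(a,r)$ denote closed balls in $X$ and $Y$. $X$ admits weighted Chebyshev centers for all nonempty finite subsets of $Y$ means: for every $n$, every tuple $(y_1,\dots,y_n)$ in $Y$ and all weights $\rho_1,\dots,\rho_n\ge0$, the infimum $\inf_{x\in X}\max_i\rho_i\|x-y_i\|$ is attained at some point of $X$. $Y$ has $n.X.I.P.$ in $X$ if for all $a_1,\dots,a_n\in Y$ and $r_1,\dots,r_n>0$ with $\bigcap_{i=1}^nB_X(a_i,r_i)\ne\emptyset$ one has $\bigcap_{i=1}^nB_Y(a_i,r_i+\varepsilon)\ne\emptyset$ for all $\varepsilon>0$. $Y$ is a central subspace of $X$ if for every finite family $a_1,\dots,a_n\in Y$, $r_1,\dots,r_n>0$ with $\bigcap_{i=1}^nB_X(a_i,r_i)\ne\emptyset$ one has $\bigcap_{i=1}^nB_Y(a_i,r_i)\ne\emptyset$. A Banach space $Z$ belongs to the class $(GC)$ if for every $n\in\mathbb{N}$, $a_1,\dots,a_n\in Z$ and $r_1,\dots,r_n>0$, $\bigcap_{i=1}^nB_{Z^{**}}(a_i,r_i)\ne\emptyset$ implies $\bigcap_{i=1}^nB_Z(a_i,r_i)\neq\emptyset$ ($Z$ canonically embedded in $Z^{**}$). 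*)

(* Defs.v *)
From HB Require Import structures.
From mathcomp Require Import all_boot all_order all_algebra.
From mathcomp Require Import boolp classical_sets functions reals topology.
From mathcomp Require Import normedtype.

Set Implicit Arguments.
Unset Strict Implicit.
Unset Printing Implicit Defensive.

Import Order.TTheory GRing.Theory Num.Theory.
Import numFieldNormedType.Exports.

Local Open Scope classical_set_scope.
Local Open Scope ring_scope.

Section Dual.
Context {R : realType}.
Implicit Types Z : normedModType R.

Definition dual_pred Z : {pred Z -> R^o} :=
  fun f => `[< linear f /\ continuous f >].

Arguments dual_pred : clear implicits.

Lemma dual_predP Z (f : Z -> R^o) :
  reflect (linear f /\ continuous f) (f \in dual_pred Z).
Proof. exact: asboolP. Qed.

Lemma dual_submod_closed Z : submod_closed (dual_pred Z).
Proof.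
split.
  apply/dual_predP; split; last by move=> x; exact: cvg_cst.
  by move=> a x y /=; rewrite scaler0 addr0.
move=> a f g /dual_predP[lf cf] /dual_predP[lg cg].
apply/dual_predP; split=> [b x y | x].
  rewrite !fctE lf lg !scalerDr !scalerA mulrC -!addrA; congr (_ + _).
  by rewrite addrCA.
by apply: cvgD; [apply: cvgZl_tmp; exact: cf | exact: cg].
Qed.

HB.instance Definition _ Z :=
  GRing.isSubmodClosed.Build R (Z -> R^o) (dual_pred Z) (@dual_submod_closed Z).

Record dual Z := Dual {
  dual_fun :> Z -> R^o;
  dual_funP : dual_fun \in dual_pred Z
}.

HB.instance Definition _ Z := [isSub for @dual_fun Z].
HB.instance Definition _ Z := [Choice of dual Z by <:].
HB.instance Definition _ Z := [SubChoice_isSubLmodule of dual Z by <:].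

Definition dual_norm Z (f : dual Z) : R :=
  sup [set `|f z| | z in [set z : Z | `|z| <= 1]].

Section DualNorm.
Variable Z : normedModType R.
Implicit Types f g : dual Z.

Lemma dual_linear f : linear f.
Proof. by have /dual_predP[] := dual_funP f. Qed.

Lemma dual_continuous f : continuous f.
Proof. by have /dual_predP[] := dual_funP f. Qed.

HB.instance Definition _ f :=
  GRing.isLinear.Build R Z R^o *:%R f (dual_linear f).

Lemma dual_norm_has_sup f :
  has_sup [set `|f z| | z in [set z : Z | `|z| <= 1]].
Proof.
split; first by exists `|f 0|, 0 => //=; rewrite normr0.
have /linear_bounded_continuous/bounded_funP/(_ 1)[M fM] := @dual_continuous f.
by exists M => _ [z /= z1 <-]; exact: fM.
Qed.

Lemma dual_norm_ge0 f : 0 <= dual_norm f.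
Proof.
apply: (@le_trans _ _ `|f 0|) => //.
apply: sup_upper_bound; first exact: dual_norm_has_sup.
by exists 0 => //=; rewrite normr0.
Qed.

Lemma le_dual_norm f (z : Z) : `|f z| <= dual_norm f * `|z|.
Proof.
have [->|z0] := eqVneq z 0; first by rewrite linear0 !normr0 mulr0.
rewrite -ler_pdivrMr ?normr_gt0//.
apply: sup_upper_bound; first exact: dual_norm_has_sup.
exists (`|z|^-1 *: z) => /=.
  by rewrite normrZ normfV normr_id mulVf ?normr_eq0.
by rewrite linearZ/= normrZ normfV normr_id mulrC.
Qed.

Lemma dual_norm_le f (M : R) :
  (forall z : Z, `|z| <= 1 -> `|f z| <= M) -> dual_norm f <= M.
Proof.
move=> fM; apply: ge_sup; first by case: (dual_norm_has_sup f).
by move=> _ [z /= z1 <-]; exact: fM.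
Qed.

Lemma ler_dual_normD f g : dual_norm (f + g) <= dual_norm f + dual_norm g.
Proof.
apply: dual_norm_le => z z1; apply: (le_trans (ler_normD _ _)).
by apply: lerD; (apply: (le_trans (le_dual_norm _ _));
  rewrite ler_piMr ?dual_norm_ge0).
Qed.

Lemma ler_dual_normZ (a : R) f : dual_norm (a *: f) <= `|a| * dual_norm f.
Proof.
apply: dual_norm_le => z z1; rewrite [leLHS]normrM.
by rewrite ler_wpM2l// (le_trans (le_dual_norm _ _))// ler_piMr ?dual_norm_ge0.
Qed.

Lemma dual_normZ (a : R) f : dual_norm (a *: f) = `|a| * dual_norm f.
Proof.
apply/eqP; rewrite eq_le ler_dual_normZ/=.
have [->|a0] := eqVneq a 0; first by rewrite normr0 mul0r dual_norm_ge0.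
rewrite -ler_pdivlMl ?normr_gt0// -normfV -[in leLHS](scalerK a0 f).
exact: ler_dual_normZ.
Qed.

Lemma dual_norm0_eq0 f : dual_norm f = 0 -> f = 0.
Proof.
move=> f0; apply/val_inj/funext => z; apply/eqP.
by rewrite -normr_le0 (le_trans (le_dual_norm f z))// f0 mul0r.
Qed.

HB.instance Definition _ := Lmodule_isNormed.Build R (dual Z)
  ler_dual_normD dual_normZ dual_norm0_eq0.

End DualNorm.

Lemma evaluation_dual Z (z : Z) :
  (fun f : dual Z => f z) \in dual_pred (dual Z).
Proof.
apply/dual_predP.
have lin : linear (fun f : dual Z => f z : R^o) by [].
split=> //.
pose ev := HB.pack_for {linear dual Z -> R^o} (fun f : dual Z => f z : R^o)
  (GRing.isLinear.Build R (dual Z) R^o *:%R _ lin).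
apply: (@bounded_linear_continuous R (dual Z) R^o ev).
apply/bounded_funP => r; exists (r * `|z|) => f fr /=.
by rewrite (le_trans (le_dual_norm f z))// ler_wpM2r.
Qed.

Definition bidual_embed Z (z : Z) : dual (dual Z) := Dual (evaluation_dual z).

End Dual.

Section ClosedSubspace.
Context {R : realType}.

Record closedSubspace (X : normedModType R) := ClosedSubspace {
  subspace_pred :> submodClosed X;
  subspace_closed : closed [set x | x \in subspace_pred]
}.

Record subspace_type (X : normedModType R) (Y : closedSubspace X) :=
  SubspaceType {
    subspace_val :> X;
    subspace_valP : subspace_val \in Y
  }.

Arguments subspace_val {X Y} _.

HB.instance Definition _ X Y := [isSub for @subspace_val X Y].
HB.instance Definition _ X Y := [Choice of @subspace_type X Y by <:].
HB.instance Definition _ X Y :=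
  [SubChoice_isSubLmodule of @subspace_type X Y by <:].

Section Norm.
Variables (X : normedModType R) (Y : closedSubspace X).
Implicit Types y : subspace_type Y.

Definition subspace_norm y : R := `|val y|.

Lemma ler_subspace_normD y1 y2 :
  subspace_norm (y1 + y2) <= subspace_norm y1 + subspace_norm y2.
Proof. exact: ler_normD. Qed.

Lemma subspace_normZ (a : R) y :
  subspace_norm (a *: y) = `|a| * subspace_norm y.
Proof. exact: normrZ. Qed.

Lemma subspace_norm0_eq0 y : subspace_norm y = 0 -> y = 0.
Proof. by move=> /normr0_eq0 y0; exact: val_inj. Qed.

HB.instance Definition _ := Lmodule_isNormed.Build R (subspace_type Y)
  ler_subspace_normD subspace_normZ subspace_norm0_eq0.

End Norm.

Section Complete.
Variables (X : completeNormedModType R) (Y : closedSubspace X).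

Lemma subspace_complete (F : set_system (subspace_type Y)) :
  ProperFilter F -> cauchy F -> cvg F.
Proof.
move=> FF Fc.
have : cvg (subspace_val @ F).
  apply: cauchy_cvg; apply/cauchy_ballP => e e0.
  have /cauchy_ballP/(_ e e0) := Fc.
  move=> [[A B] /= [FA FB] AB].
  exists (subspace_val @` A, subspace_val @` B) => /=.
    by split; [move: FA | move: FB]; apply: filterS => y ?; exists y.
  move=> [_ _] /= [[a Aa <-] [b Bb <-]].
  by have := AB (a, b) (conj Aa Bb); rewrite -!ball_normE.
move=> /cvg_ex[l Fl].
have lY : l \in Y.
  apply: (closed_cvg _ (@subspace_closed _ Y) _ _ Fl).
  by apply: nearW => y; exact: subspace_valP.
apply/cvg_ex; exists (SubspaceType lY).
apply/cvgrPdist_lt => e e0.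
by move/cvgrPdist_lt : Fl => /(_ e e0).
Qed.

HB.instance Definition _ :=
  Uniform_isComplete.Build (subspace_type Y) subspace_complete.

End Complete.
End ClosedSubspace.

Section Properties.
Context {R : realType}.

(* [closed_ball_ Num.norm a r] is [{x | `|a - x| <= r}].  The subspace [Y] is a
   normed space of its own, so [closed_ball_ Num.norm (a i) _] with
   [a i : subspace_type Y] is a ball of [Y], and with [val (a i)] a ball of
   [X]. *)

Definition admits_weighted_Chebyshev_centers (X : normedModType R)
    (Y : closedSubspace X) : Prop :=
  forall (n : nat) (y : 'I_n -> subspace_type Y) (rho : 'I_n -> R),
    (0 < n)%N -> (forall i, 0 <= rho i) ->
    (* the terms are nonnegative, so the default 0 does not affect the maximum *)
    let radius (x : X) := \big[Num.max/0]_(i < n) (rho i * `|x - val (y i)|) in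
    exists x0 : X, radius x0 = inf (range radius).

Definition nXIP (n : nat) (X : normedModType R) (Y : closedSubspace X) : Prop :=
  forall (a : 'I_n -> subspace_type Y) (r : 'I_n -> R),
    (forall i, 0 < r i) ->
    \bigcap_i closed_ball_ Num.norm (val (a i)) (r i) !=set0 ->
    forall eps : R, 0 < eps ->
    \bigcap_i closed_ball_ Num.norm (a i) (r i + eps) !=set0.

Definition central_subspace (X : normedModType R) (Y : closedSubspace X) :
    Prop :=
  forall (n : nat) (a : 'I_n -> subspace_type Y) (r : 'I_n -> R),
    (forall i, 0 < r i) ->
    \bigcap_i closed_ball_ Num.norm (val (a i)) (r i) !=set0 ->
    \bigcap_i closed_ball_ Num.norm (a i) (r i) !=set0.

Definition class_GC (Z : completeNormedModType R) : Prop :=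
  forall (n : nat) (a : 'I_n -> Z) (r : 'I_n -> R),
    (forall i, 0 < r i) ->
    \bigcap_i closed_ball_ Num.norm (bidual_embed (a i)) (r i) !=set0 ->
    \bigcap_i closed_ball_ Num.norm (a i) (r i) !=set0.

End Properties.

(* Main.v *)
From HB Require Import structures.
Require Import Defs.
From mathcomp Require Import all_boot all_order all_algebra.
From mathcomp Require Import boolp classical_sets functions reals topology.
From mathcomp Require Import normedtype.

Set Implicit Arguments.
Unset Strict Implicit.
Unset Printing Implicit Defensive.

Import Order.TTheory GRing.Theory Num.Theory.
Import numFieldNormedType.Exports.

Local Open Scope classical_set_scope.
Local Open Scope ring_scope.

(** Write [Z] for [Y] as a normed space of its own, and let balls of centres
    [a i] and radii [r i] be given.  Everything rests on an equivalence valid in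
    every normed space [Z]: the balls meet in the bidual of [Z] if and only if,
    for every [e > 0], the balls enlarged by [e] meet in [Z].

    Granted this, both directions are short.  If [Y] is central and the balls
    meet in the bidual, then points of [Y], hence of [X], are almost in all of
    them, so the infimum over [X] of the largest [`|x - a i| / r i] is at most
    1; a Chebyshev centre with weights [1 / r i] attains it and lies in all the
    balls of [X], and centrality brings the common point back to [Y].
    Conversely, if [Y] is in the class (GC) and the balls meet in [X], the
    intersection property puts points of [Y] in the enlarged balls, so the balls
    meet in the bidual, and (GC) brings the common point back to [Y].

    Each half of the equivalence is one application of the Hahn-Banach theorem
    in the form: a sublinear [p] dominates a linear functional that agrees with
    [p] at a prescribed vector.

    - From the bidual to [Z] ([diag_dist_le1]).  On [Z^n] take for [p v] the
      distance from [v] to the diagonal, for the norm with weights [1 / r i].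
      The functional obtained at [a] is given by [g i] in the dual of [Z] with
      [\sum_i r i * `|g i| <= 1]; it vanishes on the diagonal, so
      [\sum_i g i = 0].  If [phi] is in all the balls of the bidual, then
      [p a = \sum_i (g i (a i) - phi (g i)) <= \sum_i r i * `|g i| <= 1].
      This replaces the principle of local reflexivity.

    - From [Z] to the bidual ([bidual_ball_of_approx]).  On the dual of [Z] take
      for [p f] the infimum over [e] of the supremum of [f] on the common part
      of the balls enlarged by [e].  Any linear functional below [p] is in all
      the balls of the bidual.  This replaces weak-star compactness.

    The Hahn-Banach theorem itself is obtained from minimal sublinear
    functionals, which exist by the lemma of Zorn and are linear. *)

(** * Sublinear functionals and the Hahn-Banach theorem *)

Section HahnBanach.
Context {R : realType} {V : lmodType R}.
Implicit Types (p q : V -> R) (x y v : V).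

(** The inequality for [c >= 0] already gives equality ([sublinearZ]), and it is
    all that has to be checked for an infimum. *)
Definition sublinear p :=
  (forall x y, p (x + y) <= p x + p y) /\
  (forall (c : R) x, 0 <= c -> p (c *: x) <= c * p x).

Lemma sublinear0 p : sublinear p -> p 0 = 0.
Proof.
move=> [pD pZ]; apply/eqP; rewrite eq_le; apply/andP; split.
  by have := pZ 0 0 (lexx _); rewrite scale0r mul0r.
by have := pD 0 0; rewrite addr0 -lerBlDr subrr.
Qed.

Lemma sublinearZ p (c : R) x : sublinear p -> 0 <= c -> p (c *: x) = c * p x.
Proof.
move=> sp; rewrite le_eqVlt => /predU1P[<-|c0].
  by rewrite scale0r mul0r sublinear0.
apply/eqP; rewrite eq_le sp.2 ?(ltW c0)//= -ler_pdivlMl//.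
have := sp.2 c^-1 (c *: x); rewrite scalerK ?gt_eqF//.
by apply; rewrite invr_ge0 ltW.
Qed.

Lemma sublinear_opp_ge p x : sublinear p -> - p (- x) <= p x.
Proof.
move=> sp; rewrite -subr_ge0 opprK -(sublinear0 sp) -(subrr x).
exact: sp.1.
Qed.

(** The two closure conditions on the family [F] cover both ways in which
    infima are taken below: over a family directed downwards, where [k] is
    a member below [F i] and [F j], and over a parameter in which [F] is itself
    sublinear, where [k] is the sum of the parameters. *)
Lemma sublinear_inf (I : Type) (D : set I) (F : I -> V -> R) :
  D !=set0 ->
  (forall x, has_lbound [set F i x | i in D]) ->
  (forall i j x y, D i -> D j ->
    exists2 k, D k & F k (x + y) <= F i x + F j y) ->
  (forall i (c : R) x, D i -> 0 <= c ->
    exists2 k, D k & F k (c *: x) <= c * F i x) ->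
  sublinear (fun x => inf [set F i x | i in D]).
Proof.
move=> [i0 Di0] lbF FD FZ.
have nonempty x : [set F i x | i in D] !=set0 by exists (F i0 x), i0.
have inf_le x k : D k -> inf [set F i x | i in D] <= F k x.
  by move=> Dk; apply: ge_inf => //; exists k.
split=> [x y|c x c0].
- rewrite -lerBlDr; apply: lb_le_inf => // _ [i Di <-].
  rewrite lerBlDr -lerBlDl; apply: lb_le_inf => // _ [j Dj <-].
  rewrite lerBlDl; have [k Dk kF] := FD i j x y Di Dj.
  exact: le_trans (inf_le _ _ Dk) kF.
- have [->|c_neq0] := eqVneq c 0.
    rewrite mul0r; have [k Dk] := FZ i0 0 x Di0 (lexx _).
    by rewrite mul0r; apply: le_trans; exact: inf_le.
  have c_gt0 : 0 < c by rewrite lt_neqAle eq_sym c_neq0.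
  rewrite -ler_pdivrMl//; apply: lb_le_inf => // _ [i Di <-].
  rewrite ler_pdivrMl//; have [k Dk kF] := FZ i c x Di c0.
  exact: le_trans (inf_le _ _ Dk) kF.
Qed.

(** The sublinear functional obtained from [p] by lowering it as far as possible
    while keeping its value at [v]: it is below [p], and its value at [- v] is
    at most [- p v]. *)
Definition descent p v x : R :=
  inf [set p (x + t *: v) - t * p v | t in [set t : R | 0 <= t]].

Lemma descent_has_lbound p v x : sublinear p ->
  has_lbound [set p (x + t *: v) - t * p v | t in [set t : R | 0 <= t]].
Proof.
move=> sp; exists (- p (- x)) => _ [t /= t0 <-].
rewrite lerBrDr addrC lerBlDr -(sublinearZ _ sp t0).
by apply: le_trans (sp.1 _ _); rewrite addrC addKr.
Qed.

Lemma descent_sublinear p v : sublinear p -> sublinear (descent p v).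
Proof.
move=> sp; apply: (sublinear_inf (F := fun t x => p (x + t *: v) - t * p v)).
- by exists 0 => /=.
- by move=> x; exact: descent_has_lbound.
- move=> s t x y /= s0 t0; exists (s + t); first exact: addr_ge0.
  rewrite scalerDl mulrDl addrACA opprD [leRHS]addrACA lerD2r.
  exact: sp.1.
- move=> t c x /= t0 c0; exists (c * t); first exact: mulr_ge0.
  by rewrite -scalerA -scalerDr mulrBr mulrA lerB//; exact: sp.2.
Qed.

Lemma descent_le_at p v x (t : R) : sublinear p -> 0 <= t ->
  descent p v x <= p (x + t *: v) - t * p v.
Proof.
by move=> sp t0; apply: ge_inf; [exact: descent_has_lbound | exists t].
Qed.

Lemma descent_le p v x : sublinear p -> descent p v x <= p x.
Proof.
by move=> sp; have := descent_le_at v x sp (lexx 0);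
  rewrite scale0r addr0 mul0r subr0.
Qed.

(** Zorn applies because the infimum of a chain of sublinear functionals below
    [p] is finite: each of them is at least [- p (- x)] at [x]. *)
Lemma minimal_sublinear p : sublinear p ->
  exists q, [/\ sublinear q, forall x, q x <= p x &
    forall q', sublinear q' -> (forall x, q' x <= q x) -> q' = q].
Proof.
move=> sp.
pose T := {q : V -> R | sublinear q /\ forall x, q x <= p x}.
pose below (s t : T) := `[< forall x, sval t x <= sval s x >].
have [|||A Atot|m mmin] := @Zorn T below.
- by move=> t; apply/asboolP.
- move=> r s t /asboolP rs /asboolP st; apply/asboolP => x.
  exact: le_trans (st x) (rs x).
- move=> [s sP] [t tP] /asboolP/= st /asboolP/= ts.
  apply: eq_exist; apply/funext => x; apply/eqP.
  by rewrite eq_le st ts.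
- have [A0|A0] := pselect (A !=set0); last first.
    have pT : sublinear p /\ forall x, p x <= p x by [].
    exists (exist _ p pT) => s As; exfalso; apply: A0; exists s.
    exact: As.
  have lbA x : has_lbound [set sval t x | t in A].
    exists (- p (- x)) => _ [[t [st tp]] At /= <-].
    by apply: le_trans (sublinear_opp_ge x st); rewrite lerN2.
  have sA : sublinear (fun x => inf [set sval t x | t in A]).
    apply: sublinear_inf => //.
    + move=> s t x y As At.
      have [/asboolP st|/asboolP ts] := Atot s t As At.
        exists t => //; apply: le_trans ((svalP t).1.1 x y) _.
        by rewrite lerD2r.
      exists s => //; apply: le_trans ((svalP s).1.1 x y) _.
      by rewrite lerD2l.
    + by move=> t c x At c0; exists t => //; exact: (svalP t).1.2.
  have infA x t : A t -> inf [set sval t x | t in A] <= sval t x.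
    by move=> At; apply: ge_inf => //; exists t.
  have pA x : inf [set sval t x | t in A] <= p x.
    case: A0 => t At; apply: le_trans (infA _ _ At) _.
    exact: (svalP t).2.
  exists (exist _ (fun x => inf [set sval t x | t in A]) (conj sA pA)).
  by move=> t At; apply/asboolP => x /=; exact: infA.
- exists (sval m); case: (svalP m) => sm mp; split=> // q sq qm.
  have qp x : q x <= p x := le_trans (qm x) (mp x).
  have qE : exist _ q (conj sq qp) = m by apply: mmin; exact/asboolP.
  by rewrite -qE.
Qed.

(** Minimality forces [descent q v = q] for every [v], that is
    [q x <= q (x + v) - q v]: the inequality reverse to subadditivity. *)
Lemma minimal_sublinear_linear q : sublinear q ->
  (forall q', sublinear q' -> (forall x, q' x <= q x) -> q' = q) ->
  linear (q : V -> R^o).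
Proof.
move=> sq qmin.
have addq x v : q (x + v) = q x + q v.
  apply/eqP; rewrite eq_le sq.1 -lerBrDr /=.
  have {1}<- : descent q v = q.
    by apply: qmin (descent_sublinear v sq) _ => z; exact: descent_le.
  by have := descent_le_at v x sq ler01; rewrite scale1r mul1r.
have oppq x : q (- x) = - q x.
  by apply/eqP; rewrite -addr_eq0 -addq addNr sublinear0.
move=> c x y; rewrite addq; congr (_ + _).
have [c0|/ltW c0] := leP 0 c; first exact: sublinearZ.
by rewrite -[c in LHS]opprK scaleNr oppq sublinearZ ?oppr_ge0// mulNr opprK.
Qed.

(** A minimal functional below [descent p v], rather than below [p], takes the
    value [p v] at [v]: by linearity a bound from above at [- v] is a bound from
    below at [v]. *)
Lemma Hahn_Banach p v : sublinear p ->
  exists2 L : V -> R^o, linear L & (forall x, L x <= p x) /\ L v = p v.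
Proof.
move=> sp; have sd := descent_sublinear v sp.
have [L [sL Ld Lmin]] := minimal_sublinear sd.
have lL := minimal_sublinear_linear sL Lmin.
have Lp x : L x <= p x by exact: le_trans (Ld x) (descent_le v x sp).
exists L => //; split=> //; apply/eqP; rewrite eq_le Lp/=.
have LN : L (- v) = - L v.
  apply/eqP; rewrite -addr_eq0; apply/eqP.
  have := lL 1 (- v) v; rewrite !scale1r addNr (sublinear0 sL) => <- //.
have := le_trans (Ld (- v)) (descent_le_at v (- v) sp ler01).
by rewrite LN scale1r addNr mul1r sublinear0// sub0r lerN2.
Qed.

End HahnBanach.

(** * Elements of the dual *)

Section DualFacts.
Context {R : realType} {Z : normedModType R}.

Lemma dominated_dual (f : Z -> R^o) (M : R) :
  linear f -> (forall z, f z <= M * `|z|) -> f \in @dual_pred R Z.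
Proof.
move=> lf fM; apply/dual_predP; split=> //.
pose g := HB.pack_for {linear Z -> R^o} f
  (GRing.isLinear.Build R Z R^o *:%R _ lf).
have gN z : f (- z) = - f z by exact: (linearN g).
apply: (@bounded_linear_continuous R Z (R^o) g).
apply/bounded_funP => r; exists (`|M| * r) => z zr /=.
have Mz (w : Z) : `|w| = `|z| -> f w <= `|M| * r.
  move=> wz; apply: le_trans (fM w) _; rewrite wz.
  apply: (le_trans (ler_norm _)); rewrite normrM normr_id.
  exact: ler_wpM2l.
by rewrite ler_norml lerNl -gN !Mz// normrN.
Qed.

(** The dual norm is a supremum of absolute values; changing the sign of [z]
    removes them. *)
Lemma dual_norm_adherent (f : dual Z) (e : R) : 0 < e ->
  exists2 z : Z, `|z| <= 1 & dual_norm f - e < f z.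
Proof.
move=> e0; have [_ [z /= z1 <-] ltz] := sup_adherent e0 (dual_norm_has_sup f).
have [fz0|fz0] := leP 0 (f z : R).
  by exists z => //; rewrite (ger0_norm fz0) in ltz.
exists (- z); first by rewrite normrN.
by rewrite linearN; rewrite (ltr0_norm fz0) in ltz.
Qed.

End DualFacts.

(** * Weighted maximum norms and the distance to the diagonal *)

Section WeightedNorm.
Context {R : realType} {Z : normedModType R} (n : nat) (rho : 'I_n -> R).
Hypothesis rho_ge0 : forall i, 0 <= rho i.
Implicit Types v : 'I_n -> Z.

Definition wnorm v : R := \big[Num.max/0]_(i < n) (rho i * `|v i|).

Lemma wnorm_leP v (M : R) :
  0 <= M -> (wnorm v <= M) <-> (forall i, rho i * `|v i| <= M).
Proof.
move=> M0; split=> [/bigmax_leP[_ h] i|h]; first exact: h.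
by apply/bigmax_leP; split.
Qed.

Lemma wnorm_ge0 v : 0 <= wnorm v.
Proof. exact: bigmax_ge_id. Qed.

Lemma le_wnorm v i : rho i * `|v i| <= wnorm v.
Proof. exact: (le_bigmax _ (fun i => rho i * `|v i|)). Qed.

Lemma wnorm_sublinear : sublinear wnorm.
Proof.
split=> [v w|c v c0].
  apply/wnorm_leP => [|i]; first by rewrite addr_ge0 ?wnorm_ge0.
  apply: le_trans (lerD (le_wnorm v i) (le_wnorm w i)).
  by rewrite -mulrDr ler_wpM2l// ler_normD.
apply/wnorm_leP => [|i]; first by rewrite mulr_ge0 ?wnorm_ge0.
by rewrite normrZ (ger0_norm c0) mulrCA ler_wpM2l// le_wnorm.
Qed.

Definition diag_dist v : R :=
  inf [set wnorm (fun i => v i - y) | y in [set: Z]].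

Lemma diag_dist_has_lbound v :
  has_lbound [set wnorm (fun i => v i - y) | y in [set: Z]].
Proof. by exists 0 => _ [y _ <-]; exact: wnorm_ge0. Qed.

Lemma diag_dist_le v y : diag_dist v <= wnorm (fun i => v i - y).
Proof. by apply: ge_inf; [exact: diag_dist_has_lbound | exists y]. Qed.

Lemma diag_dist_adherent v (e : R) : 0 < e ->
  exists y, wnorm (fun i => v i - y) < diag_dist v + e.
Proof.
move=> e0.
have infv : has_inf [set wnorm (fun i => v i - y) | y in [set: Z]].
  split; last exact: diag_dist_has_lbound.
  by exists (wnorm (fun i => v i - 0)), 0.
by have [_ [y _ <-]] := inf_adherent e0 infv; exists y.
Qed.

Lemma diag_dist_sublinear : sublinear diag_dist.
Proof.
apply: (sublinear_inf (F := fun y v => wnorm (fun i => v i - y))).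
- by exists 0.
- exact: diag_dist_has_lbound.
- move=> y z v w _ _; exists (y + z) => //.
  apply: le_trans (wnorm_sublinear.1 _ _).
  rewrite le_eqVlt; apply/orP; left; apply/eqP; congr wnorm.
  by apply/funext => i; rewrite opprD addrACA.
- move=> y c v _ c0; exists (c *: y) => //.
  apply: le_trans (wnorm_sublinear.2 _ _ c0).
  rewrite le_eqVlt; apply/orP; left; apply/eqP; congr wnorm.
  by apply/funext => i; rewrite -scalerBr.
Qed.

End WeightedNorm.

(** * Balls in a normed space and in its bidual *)

Section BidualBalls.
Context {R : realType} {Z : normedModType R}.
Variables (n : nat) (a : 'I_n -> Z) (r : 'I_n -> R).
Hypothesis r_gt0 : forall i, 0 < r i.

Let rho i := (r i)^-1.

Let rho_ge0 i : 0 <= rho i.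
Proof. by rewrite invr_ge0 ltW. Qed.

Let single (i : 'I_n) (z : Z) : 'I_n -> Z := fun j => if j == i then z else 0.

Let sum_single (v : 'I_n -> Z) : \sum_i single i (v i) = v.
Proof.
apply/funext => j; rewrite fct_sumE (bigD1 j)//= /single eqxx big1 ?addr0//.
by move=> i ij; rewrite eq_sym (negbTE ij).
Qed.

Let single_linear i : linear (single i).
Proof.
move=> c y z; apply/funext => j; rewrite /single !fctE.
by case: ifP => // _; rewrite scaler0 addr0.
Qed.

Let single_wnorm i z : wnorm rho (single i z) <= rho i * `|z|.
Proof.
apply/wnorm_leP => [|j]; first by rewrite mulr_ge0.
rewrite /single; case: eqP => [->//|_].
by rewrite normr0 mulr0 mulr_ge0.
Qed.

(** The dual of [Z^n] with the norm [\max_i `|v i| / r i] is the [n]-th power of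
    the dual of [Z] with the norm [\sum_i r i * `|g i|]. *)
Lemma dual_family (L : ('I_n -> Z) -> R^o) :
  linear L -> (forall v, L v <= wnorm rho v) ->
  exists g : 'I_n -> dual Z, (forall v, L v = \sum_i g i (v i)) /\
    \sum_i r i * dual_norm (g i) <= 1.
Proof.
move=> lL LN.
pose L' := HB.pack_for {linear ('I_n -> Z) -> R^o} L
  (GRing.isLinear.Build R ('I_n -> Z) R^o *:%R _ lL).
have gP i : (fun z => L (single i z)) \in @dual_pred R Z.
  apply: (@dominated_dual _ _ _ (rho i)) => [c y z|z].
    by rewrite single_linear; exact: lL.
  exact: le_trans (LN _) (single_wnorm i z).
pose g i : dual Z := Dual (gP i).
have Lg v : L v = \sum_i g i (v i).
  by rewrite -[in LHS](sum_single v); exact: (raddf_sum L').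
exists g; split=> //; apply/ler_addgt0Pr => e e0.
(* The loss [d] in each dual norm costs [d * \sum_i r i], which is at most [e];
   the 1 in the denominator covers an empty sum. *)
pose d := e / (1 + \sum_i r i).
have S0 : 0 < 1 + \sum_i r i.
  by rewrite ltr_pwDl// sumr_ge0// => i _; rewrite ltW.
have d0 : 0 < d by rewrite divr_gt0.
have [z z1 gz] : exists2 z : 'I_n -> Z, (forall i, `|z i| <= 1) &
    forall i, dual_norm (g i) - d < g i (z i).
  have h i : exists z : Z, `|z| <= 1 /\ dual_norm (g i) - d < g i z.
    by have [z ? ?] := dual_norm_adherent (g i) d0; exists z.
  by have [z zP] := choice h; exists z => i; case: (zP i).
have : L (fun i => r i *: z i) <= 1.
  apply: le_trans (LN _) _; apply/wnorm_leP => // i.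
  rewrite normrZ gtr0_norm// mulrA mulVf ?gt_eqF// mul1r.
  exact: z1.
rewrite Lg => Lz.
have : \sum_i r i * dual_norm (g i) <= \sum_i (g i (r i *: z i) + r i * d).
  apply: ler_sum => i _; rewrite linearZ /= -lerBlDr -mulrBr.
  by rewrite /GRing.scale/= ler_wpM2l ?ltW.
move=> /le_trans; apply; rewrite big_split/=; apply: lerD => //.
rewrite -mulr_suml mulrC /d -mulrA ler_piMr ?(ltW e0)//.
by rewrite mulrC ler_pdivrMr// mul1r lerDr.
Qed.

(** With the weights [1 / r i], a distance at most 1 means that the balls
    enlarged by any factor greater than 1 meet in [Z]. *)
Lemma diag_dist_le1 (phi : dual (dual Z)) :
  (forall i, `|bidual_embed (a i) - phi| <= r i) -> diag_dist rho a <= 1.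
Proof.
move=> phir; have sd := diag_dist_sublinear (Z := Z) rho_ge0.
have [L lL [Ld La]] := Hahn_Banach a sd.
have dN (v : 'I_n -> Z) : diag_dist rho v <= wnorm rho v.
  apply: le_trans (diag_dist_le rho v 0) _.
  by rewrite le_eqVlt; apply/orP; left; apply/eqP; congr wnorm;
    apply/funext => i; rewrite subr0.
have [g [Lg g1]] := dual_family lL (fun v => le_trans (Ld v) (dN v)).
(* [L] is nonpositive on the diagonal, a subspace, so it vanishes there. *)
have g0 : \sum_i g i = 0.
  have le0 y : L (fun=> y) <= 0.
    apply: le_trans (Ld _) _; apply: le_trans (diag_dist_le _ _ y) _.
    by apply/wnorm_leP => // i; rewrite subrr normr0 mulr0.
  have sumE y : (\sum_i g i : dual Z) y = L (fun=> y).
    rewrite Lg.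
    exact: (raddf_sum (bidual_embed y : {linear dual Z -> R^o})).
  apply/val_inj/funext => y; apply: etrans (sumE y) _.
  apply/eqP; rewrite eq_le le0/= -oppr_le0.
  by have := le0 (- y); rewrite -!sumE linearN.
have phig : \sum_i phi (g i) = 0 by rewrite -raddf_sum g0; exact: (linear0 phi).
have -> : diag_dist rho a = \sum_i (g i (a i) - phi (g i)).
  by rewrite sumrB phig subr0 -La Lg.
apply: le_trans g1; apply: ler_sum => i _.
apply: (le_trans (ler_norm _)).
apply: (le_trans (le_dual_norm (bidual_embed (a i) - phi) (g i))).
by rewrite ler_wpM2r ?dual_norm_ge0//; exact: phir.
Qed.

(** The sets [C e] decrease with [e] and are nonempty and bounded, so [F e] is
    a family of finite sublinear functionals, directed downwards and bounded
    below.  A functional [phi] below all of them satisfies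
    [phi f - f (a i) <= (r i + e) * `|f|], since each [y] in [C e] does. *)
Lemma bidual_ball_of_approx :
  (forall e : R, 0 < e ->
    exists y : Z, forall i, `|a i - y| <= r i + e) ->
  exists phi : dual (dual Z), forall i, `|bidual_embed (a i) - phi| <= r i.
Proof.
move=> approx.
(* Without balls, [C e] is the whole space, where a functional may be unbounded,
   but any [phi] will do. *)
have [i0|n0] := pselect (exists i : 'I_n, True); last first.
  by exists 0 => i; exfalso; apply: n0; exists i.
case: i0 => i0 _.
pose C (e : R) := [set y : Z | forall i, `|a i - y| <= r i + e].
(* The bound [e <= 1] keeps all the [C e] in one ball. *)
pose D := [set e : R | 0 < e <= 1].
pose F (e : R) (f : dual Z) : R := sup [set (f y : R) | y in C e].
pose M := `|a i0| + r i0 + 1.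
have CM e y : D e -> C e y -> `|y| <= M.
  move=> /andP[_ e1] Cy.
  rewrite -[y in leLHS](subKr (a i0)); apply: (le_trans (ler_normB _ _)).
  by rewrite /M -addrA lerD// (le_trans (Cy i0))// lerD2l.
have fM e (f : dual Z) y : D e -> C e y -> `|f y| <= dual_norm f * M.
  move=> De Cy; apply: le_trans (le_dual_norm f y) _.
  by rewrite ler_wpM2l ?dual_norm_ge0// (CM e).
have C0 e : D e -> C e !=set0.
  by move=> /andP[e0 _]; have [y yP] := approx e e0; exists y.
have le_F e (f : dual Z) y : D e -> C e y -> f y <= F e f.
  move=> De Cy; apply: ub_le_sup; last by exists y.
  exists (dual_norm f * M) => _ [z Cz <-].
  by rewrite (le_trans (ler_norm _))// (fM e).
have F_le e (f : dual Z) (B : R) :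
    D e -> (forall y, C e y -> f y <= B) -> F e f <= B.
  move=> De fB; apply: ge_sup; last by move=> _ [y Cy <-]; exact: fB.
  by have [y Cy] := C0 e De; exists (f y), y.
have lbF f : has_lbound [set F e f | e in D].
  exists (- (dual_norm f * M)) => _ [e De <-].
  have [y Cy] := C0 e De; apply: le_trans (le_F e f y De Cy).
  by rewrite lerNl (le_trans (ler_norm _))// normrN (fM e).
have D1 : D 1 by rewrite /D/= ltr01 lexx.
have sF : sublinear (fun f => inf [set F e f | e in D]).
  apply: sublinear_inf => //.
  - by exists 1.
  - move=> e1 e2 f g De1 De2; exists (Num.min e1 e2).
      by case: leP.
    apply: F_le => [|y Cy]; first by case: leP.
    apply: lerD; apply: le_F => // i; apply: le_trans (Cy i) _;
      by rewrite lerD2l ge_min lexx ?orbT.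
  - move=> e c f De c0; exists e => //; apply: F_le => // y Cy.
    by apply: ler_wpM2l => //; exact: le_F.
have [phi lphi [phiF _]] := Hahn_Banach 0 sF.
have phi_le e i f : D e -> phi f <= f (a i) + (r i + e) * dual_norm f.
  move=> De; apply: le_trans (phiF f) _.
  apply: (@le_trans _ _ (F e f)); first by apply: ge_inf => //; exists e.
  apply: F_le => // y Cy; rewrite -lerBlDl -linearB.
  apply: (le_trans (ler_norm _)); apply: (le_trans (le_dual_norm _ _)).
  by rewrite mulrC ler_wpM2r ?dual_norm_ge0// distrC.
have phiP : phi \in @dual_pred R (dual Z).
  apply: (@dominated_dual _ _ _ (`|a i0| + (r i0 + 1))) => // f.
  apply: le_trans (phi_le 1 i0 f D1) _; rewrite [leRHS]mulrDl lerD2r.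
  by rewrite (le_trans (ler_norm _))// mulrC; exact: le_dual_norm.
exists (Dual phiP) => i; apply: dual_norm_le => f f1.
have half (g : dual Z) : `|g| <= 1 -> phi g - g (a i) <= r i.
  move=> g1; apply/ler_addgt0Pr => e e0.
  have De : D (Num.min e 1).
    by rewrite /D/= lt_min e0 ltr01 ge_min lexx orbT.
  rewrite lerBlDl; apply: le_trans (phi_le _ i g De) _; rewrite lerD2l.
  apply: (@le_trans _ _ (r i + Num.min e 1)).
    by rewrite ler_piMr// addr_ge0 ?ltW//; case/andP: De.
  by rewrite lerD2l ge_min lexx.
rewrite distrC ler_norml half// andbT lerNl.
have := half (- f); rewrite normrN => /(_ f1).
have -> : phi (- f) = - phi f.
  exact: (linearN (Dual phiP)).
by rewrite -opprD.
Qed.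

End BidualBalls.

(** * Central subspaces and the class (GC) *)

Theorem theorem2p8 (R : realType) (X : completeNormedModType R)
    (Y : closedSubspace X) :
  admits_weighted_Chebyshev_centers Y ->
  (forall n : nat, nXIP n Y) ->
  (central_subspace Y <-> class_GC (subspace_type Y)).
Proof.
move=> cheb xip; split=> [central|gc] n a r r0 [x xr].
- apply: central => //.
  have [n0|n_gt0] := posnP n.
    by exists 0 => i; have := ltn_ord i; rewrite [X in leq _ X]n0.
  have rho_ge0 i : 0 <= (r i)^-1 by rewrite invr_ge0 ltW.
  have [x0] := cheb n a (fun i => (r i)^-1) n_gt0 rho_ge0.
  set radius := (X in range X) => x0E.
  have radius_le1 : radius x0 <= 1.
    apply/ler_addgt0Pr => e e0; rewrite [leLHS]x0E.
    have d1 := diag_dist_le1 r0 (fun i => xr i I).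
    have [y yd] := diag_dist_adherent (fun i => (r i)^-1) a e0.
    apply: (@le_trans _ _ (radius (val y))).
      apply: ge_inf; last by exists (val y).
      by exists 0 => _ [z _ <-]; exact: bigmax_ge_id.
    apply: (@le_trans _ _ (diag_dist (fun i => (r i)^-1) a + e)); last first.
      by rewrite lerD2r.
    apply: le_trans (ltW yd); rewrite le_eqVlt; apply/orP; left; apply/eqP.
    by apply: eq_bigr => i _; rewrite distrC.
  exists x0 => i _; rewrite /closed_ball_/= distrC.
  have /bigmax_leP[_ /(_ i isT)] := radius_le1.
  by rewrite ler_pdivrMl// mulr1.
- apply: gc => //.
  have [|phi phir] := @bidual_ball_of_approx _ _ n a r r0; last first.
    by exists phi => i _; exact: phir.
  move=> e e0; have [|y yr] := xip n a r r0 _ e e0; first by exists x.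
  by exists y => i; exact: yr.
Qed.
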